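(* Let $R$ be a finite commutative unital ring and let $\mathcal B$ be the category of commutative unital $R$-algebras. Let $R^{R}=\mathrm{Hom}_{\mathrm{Set}}(|R|,R)$ be the $R$-algebra of all functions $|R|\to R$, with its co-$\mathcal B$-algebra structure. The monoid structure on $\mathrm{Hom}_{\mathrm{Set}}(|R|,|R|)$ (composition of maps, with the identity map as unit) makes $R^{R}$ into a Tall–Wraith $\mathcal B$-monoid. Moreover, the contravariant functor $X\mapsto\mathrm{Hom}_{\mathrm{Set}}(X,R)$ from $\mathrm{Set}$ to $\mathcal B$ lifts to a (contravariant) functor from $\mathrm{Set}$ to the category of $R^{R}$-modules in $\mathcal B$.
   Context: A co-$\mathcal B$-algebra object in $\mathcal B$ is an $R$-algebra $T$ with co-operations $T\to T^{\otimes_R n}$, one for each $n$-ary $R$-algebra operation, satisfying the dual identities; equivalently, with a lift of $\mathrm{Hom}_{\mathcal B}(T,-)$ to a functor $\mathcal B\to\mathcal B$. $\mathrm{Hom}_{\mathcal B}(T,B)$ denotes the resulting $R$-algebra. Let $\mathcal B^{c}$ be the category of such objects. The Tall–Wraith monoidal structure $(\mathcal B^{c},\odot,I)$ is characterised by $\mathrm{Hom}_{\mathcal B}(T_1\odot T_2,B)\cong\mathrm{Hom}_{\mathcal B}(T_1,\mathrm{Hom}_{\mathcal B}(T_2,B))$ and $\mathrm{Hom}_{\mathcal B}(I,B)\cong B$ (so $I$ has underlying algebra $R[x]$); a Tall–Wraith $\mathcal B$-monoid is a monoid in it. The co-$\mathcal B$-structure on $R^{R}$: since $R$ is finite, the canonical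 map $(R^{R})^{\otimes_R n}\to\mathrm{Hom}_{\mathrm{Set}}(|R|^{n},R)$ is an isomorphism, and the co-operation of an $n$-ary $R$-algebra operation $\omega$ is precomposition with $\omega\colon|R|^{n}\to|R|$ followed by the inverse of this isomorphism. For $f\in T_1$, $g\in T_2$, write $f\odot g\in T_1\odot T_2$ for the value at $g$ of the image of $f$ under the universal map $T_1\to\mathrm{Hom}_{\mathcal B}(T_2,T_1\odot T_2)$; the multiplication $R^{R}\odot R^{R}\to R^{R}$ is induced by composition via $f\odot g\mapsto g\circ f$, and the unit $R[x]\to R^{R}$ sends $x$ to the identity map. For a Tall–Wraith $\mathcal B$-monoid $T$, a $T$-module in $\mathcal B$ is an $R$-algebra $B$ with a morphism $B\to\mathrm{Hom}_{\mathcal B}(T,B)$ (equivalently $B\odot T\to B$, where $B\odot-$ is defined by the same adjunction) satisfying the usual associativity and unit conditions with respect to the multiplication and unit of $T$. On $\mathrm{Hom}_{\mathrm{Set}}(X,R)$ the action is by post-composition: $\phi\mapsto(f\mapsto f\circ\phi)$. *)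

(* Defs.v *)
From HB Require Import structures.
From mathcomp Require Import all_boot all_order all_algebra.
From mathcomp Require Import generic_quotient boolp functions.
Set Implicit Arguments.
Unset Strict Implicit.
Unset Printing Implicit Defensive.

Import GRing.Theory.
Local Open Scope quotient_scope.
Local Open Scope ring_scope.

(* The library's [comAlgType R] excludes the zero ring.  The category of      *)
(* [R]-algebras must contain it (it is [X -> R] for empty [X]), and [R]       *)
(* itself may be zero, so everything is built on the possibly-zero ([Pz])     *)
(* rings.  An algebra is given by its structure map [R -> A]; the scalar      *)
(* multiple of [x] by [a] is [a *a x].                                        *)
HB.mixin Record ComPzRing_isAlgebra (R : comPzRingType) A
    of GRing.ComPzRing A := {
  algmap : R -> A;
  algmap_is_zmod_morphism : zmod_morphism algmap;
  algmap_is_monoid_morphism : GRing.monoid_morphism algmap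
}.

#[short(type="comPzAlgType")]
HB.structure Definition ComPzAlgebra (R : comPzRingType) :=
  {A of GRing.ComPzRing A & ComPzRing_isAlgebra R A}.

Notation "a *a x" := (algmap a * x) (at level 40, left associativity).

HB.instance Definition _ (R : comPzRingType) (A : comPzAlgType R) :=
  GRing.isZmodMorphism.Build R A algmap algmap_is_zmod_morphism.
HB.instance Definition _ (R : comPzRingType) (A : comPzAlgType R) :=
  GRing.isMonoidMorphism.Build R A algmap algmap_is_monoid_morphism.

Section RegularAlgebra.
Variable R : comPzRingType.
Let reg_algmap : R -> R^o := id.
Fact reg_algmap_zmod : zmod_morphism reg_algmap. Proof. by []. Qed.
Fact reg_algmap_monoid : GRing.monoid_morphism reg_algmap. Proof. by []. Qed.
HB.instance Definition _ :=
  ComPzRing_isAlgebra.Build R R^o reg_algmap_zmod reg_algmap_monoid.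
End RegularAlgebra.

Section FunAlgebra.
Variables (R : comPzRingType) (X : Type) (A : comPzAlgType R).

Let fct_algmap (a : R) : X -> A := fun=> algmap a.

Fact fct_algmap_zmod : zmod_morphism fct_algmap.
Proof. by move=> a b; apply/funext => x; rewrite /fct_algmap rmorphB. Qed.

Fact fct_algmap_monoid : GRing.monoid_morphism fct_algmap.
Proof.
by split=> [|a b]; apply/funext => x; rewrite /fct_algmap ?rmorph1 ?rmorphM.
Qed.

HB.instance Definition _ :=
  ComPzRing_isAlgebra.Build R (X -> A) fct_algmap_zmod fct_algmap_monoid.

End FunAlgebra.

Definition setHom (R : comPzRingType) (X : Type) : comPzAlgType R :=
  (X -> R^o)%type.

Section Morphisms.
Variable R : comPzRingType.
Implicit Types A B C : comPzAlgType R.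

Definition alg_morphism A B (f : A -> B) : Prop :=
  [/\ {morph f : x y / x + y}, GRing.monoid_morphism f
    & forall (a : R) x, f (a *a x) = a *a f x].

Record algHom A B := AlgHom {
  alg_fun :> A -> B;
  alg_funP : alg_morphism alg_fun
}.

Lemma algHom_eq A B (f g : algHom A B) : f =1 g -> f = g.
Proof.
case: f g => [f fP] [g gP] /= /funext fg; subst g.
by rewrite (Prop_irrelevance fP gP).
Qed.

Fact idHom_proof A : alg_morphism (@id A). Proof. by []. Qed.
Definition idHom A : algHom A A := AlgHom (@idHom_proof A).

Fact compHom_proof A B C (g : algHom B C) (f : algHom A B) :
  alg_morphism (g \o f).
Proof.
have [fD [f1 fM] fZ] := alg_funP f; have [gD [g1 gM] gZ] := alg_funP g.
split=> [x y | | a x] /=; first by rewrite fD gD.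
  by split=> [|x y] /=; rewrite ?f1 ?fM ?g1 ?gM.
by rewrite fZ gZ.
Qed.
Definition compHom A B C (g : algHom B C) (f : algHom A B) : algHom A C :=
  AlgHom (compHom_proof g f).

End Morphisms.

Notation "g \oA f" := (compHom g f) (at level 50, left associativity).

Inductive alg_op (R : Type) :=
  OpZero | OpOne | OpOpp | OpAdd | OpMul | OpScale of R.
Arguments OpZero {R}. Arguments OpOne {R}. Arguments OpOpp {R}.
Arguments OpAdd {R}. Arguments OpMul {R}.

Definition arity R (w : alg_op R) : nat :=
  match w with
  | OpZero | OpOne => 0
  | OpOpp | OpScale _ => 1
  | OpAdd | OpMul => 2
  end.

Definition op_eval (R : comPzRingType) (A : comPzAlgType R) (w : alg_op R) :
    ('I_(arity w) -> A) -> A :=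
  match w with
  | OpZero => fun _ => 0
  | OpOne => fun _ => 1
  | OpOpp => fun x => - x ord0
  | OpAdd => fun x => x ord0 + x ord_max
  | OpMul => fun x => x ord0 * x ord_max
  | OpScale a => fun x => a *a x ord0
  end.

Inductive term (R V : Type) :=
  | Var of V
  | App (w : alg_op R) of ('I_(arity w) -> term R V).

HB.instance Definition _ R V := gen_eqMixin (term R V).
HB.instance Definition _ R V := gen_choiceMixin (term R V).

Section Terms.
Variable R : comPzRingType.

Fixpoint eval V (A : comPzAlgType R) (v : V -> A) (s : term R V) : A :=
  match s with
  | Var x => v x
  | App w a => op_eval (fun i => eval v (a i))
  end.

Definition alg_identity V (s t : term R V) : Prop :=
  forall (A : comPzAlgType R) (v : V -> A), eval v s = eval v t.

Lemma hom_op (A B : comPzAlgType R) (f : algHom A B) w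
  (x : 'I_(arity w) -> A) : f (op_eval x) = op_eval (fun i => f (x i)).
Proof.
have [fD [f1 fM] fZ] := alg_funP f.
have f0 : f 0 = 0 by apply: (@addrI _ (f 0)); rewrite -fD !addr0.
have fN u : f (- u) = - f u.
  by apply: (@addrI _ (f u)); rewrite -fD !subrr f0.
by case: w x => [||||| a] x /=.
Qed.

Lemma op_hom (A B : comPzAlgType R) (f : A -> B) :
  (forall w (x : 'I_(arity w) -> A),
     f (op_eval x) = op_eval (fun i => f (x i))) ->
  alg_morphism f.
Proof.
move=> fop; split=> [x y||a x].
- exact: (fop OpAdd (tnth [tuple x; y])).
- split=> [|x y]; first exact: (fop OpOne (fun=> 0)).
  exact: (fop OpMul (tnth [tuple x; y])).
- exact: (fop (OpScale a) (tnth [tuple x])).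
Qed.

Definition opHom (A B : comPzAlgType R) (f : A -> B) fop : algHom A B :=
  AlgHom (@op_hom A B f fop).

Lemma hom_eval V (A B : comPzAlgType R) (f : algHom A B) (v : V -> A) s :
  f (eval v s) = eval (fun x => f (v x)) s.
Proof.
elim: s => //= w a IH; rewrite hom_op; congr op_eval.
by apply/funext => i; exact: IH.
Qed.

End Terms.

(* [ok v] singles out, among the maps [v] from the set [G] of generators to   *)
(* an algebra, those that satisfy the desired relations.  [pres ok] is the    *)
(* term algebra on [G] modulo the equations that hold under every such [v];   *)
(* [pres_lift] and [pres_hom_eq] are its universal property.                  *)
Section Presentation.
Variables (R : comPzRingType) (G : Type).
Variable ok : forall B : comPzAlgType R, (G -> B) -> Prop.

Definition pres_rel (s t : term R G) : Prop :=
  forall (B : comPzAlgType R) (v : G -> B), ok v -> eval v s = eval v t.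

Definition pres_relb (s t : term R G) : bool := `[< pres_rel s t >].

Lemma pres_equiv : equiv_class_of pres_relb.
Proof.
split=> [s | s t | t s u].
- by apply/asboolP.
- by apply/asboolP/asboolP => h B v okv; rewrite h.
- move=> /asboolP st /asboolP tu; apply/asboolP => B v okv.
  by rewrite st ?tu.
Qed.

Canonical pres_equiv_rel := EquivRelPack pres_equiv.

Definition pres := {eq_quot pres_equiv_rel}.
HB.instance Definition _ := Choice.on pres.

Definition pres_op w (x : 'I_(arity w) -> pres) : pres :=
  \pi_pres (App (fun i => repr (x i))).

Definition pres_eval (B : comPzAlgType R) (v : G -> B) (x : pres) : B :=
  eval v (repr x).

Lemma presP (s t : term R G) : \pi_pres s = \pi_pres t <-> pres_rel s t.
Proof.
split=> [/eqmodP /asboolP //|st].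
by apply/eqmodP/asboolP.
Qed.

Lemma pres_evalE (B : comPzAlgType R) (v : G -> B) s :
  ok v -> pres_eval v (\pi_pres s) = eval v s.
Proof.
by move=> okv; have /presP/(_ B v okv) := reprK (\pi_pres s).
Qed.

Lemma pres_eval_op (B : comPzAlgType R) (v : G -> B) w
    (x : 'I_(arity w) -> pres) :
  ok v -> pres_eval v (pres_op x) = op_eval (fun i => pres_eval v (x i)).
Proof. by move=> okv; rewrite /pres_op pres_evalE. Qed.

Lemma pres_sep (x y : pres) :
  (forall (B : comPzAlgType R) (v : G -> B), ok v ->
     pres_eval v x = pres_eval v y) -> x = y.
Proof.
by move=> xy; rewrite -[x]reprK -[y]reprK; apply/presP.
Qed.

Definition pres0 : pres := @pres_op OpZero (tnth [tuple]).
Definition pres1 : pres := @pres_op OpOne (tnth [tuple]).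
Definition presN (x : pres) : pres := @pres_op OpOpp (tnth [tuple x]).
Definition presD (x y : pres) : pres := @pres_op OpAdd (tnth [tuple x; y]).
Definition presM (x y : pres) : pres := @pres_op OpMul (tnth [tuple x; y]).
Definition presZ (a : R) (x : pres) : pres :=
  @pres_op (OpScale a) (tnth [tuple x]).

Section PresEval.
Variables (B : comPzAlgType R) (v : G -> B) (okv : ok v).
Let ev_op w x := @pres_eval_op B v w x okv.
Fact pres_eval0 : pres_eval v pres0 = 0. Proof. exact: ev_op. Qed.
Fact pres_eval1 : pres_eval v pres1 = 1. Proof. exact: ev_op. Qed.
Fact pres_evalN x : pres_eval v (presN x) = - pres_eval v x.
Proof. exact: ev_op. Qed.
Fact pres_evalD x y : pres_eval v (presD x y) = pres_eval v x + pres_eval v y.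
Proof. exact: ev_op. Qed.
Fact pres_evalM x y : pres_eval v (presM x y) = pres_eval v x * pres_eval v y.
Proof. exact: ev_op. Qed.
Fact pres_evalZ a x : pres_eval v (presZ a x) = a *a pres_eval v x.
Proof. exact: ev_op. Qed.
Definition pres_evalE' := (pres_eval0, pres_eval1, pres_evalN, pres_evalD,
  pres_evalM, pres_evalZ).
End PresEval.

Local Ltac pres_law lem :=
  repeat (hnf; intro); apply: pres_sep => B v okv;
  rewrite !pres_evalE' //; exact: lem.

Fact presDA : associative presD. Proof. pres_law addrA. Qed.
Fact presDC : commutative presD. Proof. pres_law addrC. Qed.
Fact pres0D : left_id pres0 presD. Proof. pres_law add0r. Qed.
Fact presND : left_inverse pres0 presN presD. Proof. pres_law addNr. Qed.
HB.instance Definition _ :=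
  GRing.isZmodule.Build pres presDA presDC pres0D presND.

Fact presMA : associative presM. Proof. pres_law mulrA. Qed.
Fact presMC : commutative presM. Proof. pres_law mulrC. Qed.
Fact pres1M : left_id pres1 presM. Proof. pres_law mul1r. Qed.
Fact presMD : left_distributive presM presD. Proof. pres_law mulrDl. Qed.
HB.instance Definition _ :=
  GRing.Zmodule_isComPzRing.Build pres presMA presMC pres1M presMD.

Definition pres_algmap (a : R) : pres := presZ a 1.

Fact pres_algmap_zmod : zmod_morphism pres_algmap.
Proof.
move=> a b; apply: pres_sep => B v okv.
change (pres_eval v (presZ (a - b) pres1) =
        pres_eval v (presD (presZ a pres1) (presN (presZ b pres1)))).
by rewrite !pres_evalE' // rmorphB mulrBl.
Qed.

Fact pres_algmap_monoid : GRing.monoid_morphism pres_algmap.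
Proof.
split=> [|a b]; apply: pres_sep => B v okv.
  change (pres_eval v (presZ 1 pres1) = pres_eval v pres1).
  by rewrite !pres_evalE' // rmorph1 mul1r.
change (pres_eval v (presZ (a * b) pres1) =
        pres_eval v (presM (presZ a pres1) (presZ b pres1))).
by rewrite !pres_evalE' // rmorphM !mulr1.
Qed.

HB.instance Definition _ :=
  ComPzRing_isAlgebra.Build R pres pres_algmap_zmod pres_algmap_monoid.

Definition pres_gen (x : G) : pres := \pi_pres (Var R x).

Section Lift.
Variables (B : comPzAlgType R) (v : G -> B) (okv : ok v).

Fact pres_lift_op w (x : 'I_(arity w) -> pres) :
  pres_eval v (op_eval x) = op_eval (fun i => pres_eval v (x i)).
Proof.
case: w x => [||||| a] x; [exact: pres_eval0 | exact: pres_eval1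
  | exact: pres_evalN | exact: pres_evalD | exact: pres_evalM |].
change (pres_eval v (presM (presZ a pres1) (x ord0)) =
        a *a pres_eval v (x ord0)).
by rewrite !pres_evalE' // mulr1.
Qed.

Definition pres_lift : algHom pres B := opHom pres_lift_op.

Lemma pres_lift_gen x : pres_lift (pres_gen x) = v x.
Proof. exact: pres_evalE. Qed.

End Lift.

Lemma pres_lift_sep (x y : pres) :
  (forall (B : comPzAlgType R) (v : G -> B) (okv : ok v),
     pres_lift okv x = pres_lift okv y) -> x = y.
Proof. by move=> xy; apply: pres_sep => B v okv; exact: (xy B v okv). Qed.

Lemma pres_eval_gen (s : term R G) : eval pres_gen s = \pi_pres s.
Proof.
apply: pres_lift_sep => B v okv; rewrite hom_eval /= pres_evalE //.
by congr (eval _ s); apply/funext => x; exact: pres_lift_gen.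
Qed.

Lemma pres_hom_eq (B : comPzAlgType R) (f g : algHom pres B) :
  (forall x, f (pres_gen x) = g (pres_gen x)) -> f = g.
Proof.
move=> fg; apply: algHom_eq => x; rewrite -[x]reprK -pres_eval_gen !hom_eval.
by congr (eval _ _); apply/funext.
Qed.

End Presentation.

Section Tensor.
Variables (R : comPzRingType) (T : comPzAlgType R) (n : nat).
Implicit Types (B : comPzAlgType R) (tau : 'I_n -> T).

(* The relations between pure tensors: [R]-linearity in each variable, and    *)
(* the multiplication and unit of the tensor product of algebras, where       *)
(* products in ['I_n -> T] are componentwise.                                 *)
Definition tensor_rel B (v : ('I_n -> T) -> B) : Prop :=
  [/\ forall tau i x y, v [eta tau with i |-> x + y]
        = v [eta tau with i |-> x] + v [eta tau with i |-> y],
      forall tau i (a : R) x, v [eta tau with i |-> a *a x]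
        = a *a v [eta tau with i |-> x]
    & GRing.monoid_morphism v].

Definition tensor : comPzAlgType R := pres tensor_rel.
Definition pure tau : tensor := pres_gen tensor_rel tau.

Fact pure_rel : tensor_rel pure.
Proof.
split=> [tau i x y | tau i a x |]; last split=> [|sigma tau];
  apply: pres_lift_sep => B v okv; have [vD vZ [v1 vM]] := okv;
  have [fD [f1 fM] fZ] := alg_funP (pres_lift okv);
  rewrite ?fD ?fZ ?fM ?f1 !(pres_lift_gen okv).
- exact: vD.
- exact: vZ.
- exact: v1.
- exact: vM.
Qed.

Section Inj.
Variable i : 'I_n.

Definition tensor_inj_fun (x : T) : tensor := pure [eta fun=> 1 with i |-> x].

Fact tensor_inj_proof : alg_morphism tensor_inj_fun.
Proof.
have [pD pZ [p1 pM]] := pure_rel.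
split=> [x y | | a x]; [exact: pD | | exact: pZ].
split=> [|x y]; rewrite /tensor_inj_fun.
  by rewrite -p1; congr pure; apply/funext => j /=; case: eqP.
rewrite -pM; congr pure; apply/funext => j /=.
by rewrite -[RHS]/(_ j * _ j) /=; case: eqP; rewrite ?mulr1.
Qed.

(* x |-> 1 (x) ... (x) 1 (x) x (x) 1 (x) ... (x) 1, with [x] in position [i] *)
Definition tensor_inj : algHom T tensor := AlgHom tensor_inj_proof.

End Inj.

Lemma pure_prod tau : pure tau = \prod_i tensor_inj i (tau i).
Proof.
have [_ _ [p1 pM]] := pure_rel.
rewrite /= /tensor_inj_fun -(big_morph pure pM p1); congr pure.
apply/funext => j; rewrite fct_prodE (bigD1 j) //= eqxx big1 ?mulr1 //.
by move=> i; rewrite eq_sym => /negbTE ->.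
Qed.

Section Copair.
Variables (B : comPzAlgType R) (f : 'I_n -> algHom T B).

Fact prod_with tau i x :
  \prod_j f j ([eta tau with i |-> x] j)
    = f i x * \prod_(j | j != i) f j (tau j).
Proof.
rewrite (bigD1 i) //= eqxx; congr (_ * _).
by apply: eq_bigr => j /negbTE ->.
Qed.

Fact copair_proof : tensor_rel (fun tau => \prod_i f i (tau i)).
Proof.
split=> [tau i x y | tau i a x |]; last split=> [|sigma tau].
- by have [fD _ _] := alg_funP (f i); rewrite !prod_with fD mulrDl.
- by have [_ _ fZ] := alg_funP (f i); rewrite !prod_with fZ mulrA.
- by apply: big1 => i _; have [_ [f1 _] _] := alg_funP (f i).
- rewrite -big_split; apply: eq_bigr => i _.
  by have [_ [_ fM] _] := alg_funP (f i); exact: fM.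
Qed.

Definition copair : algHom tensor B := pres_lift copair_proof.

Lemma copair_pure tau : copair (pure tau) = \prod_i f i (tau i).
Proof. exact: pres_lift_gen. Qed.

Lemma copair_inj i x : copair (tensor_inj i x) = f i x.
Proof.
rewrite -[LHS]/(copair (pure [eta fun=> 1 with i |-> x])) copair_pure.
rewrite prod_with big1 ?mulr1 // => j _.
by have [_ [f1 _] _] := alg_funP (f j).
Qed.

End Copair.

Lemma tensor_hom_eq B (f g : algHom tensor B) :
  (forall i, f \oA tensor_inj i = g \oA tensor_inj i) -> f = g.
Proof.
move=> fg; apply: pres_hom_eq => tau; rewrite -/(pure tau) pure_prod.
have [_ [f1 fM] _] := alg_funP f; have [_ [g1 gM] _] := alg_funP g.
rewrite (big_morph f fM f1) (big_morph g gM g1); apply: eq_bigr => i _.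
by have := fg i => /(congr1 (fun h => alg_fun h (tau i))).
Qed.

End Tensor.

Definition tensor_map (R : comPzRingType) (S T : comPzAlgType R) n
    (f : algHom S T) : algHom (tensor S n) (tensor T n) :=
  copair (fun i => tensor_inj T i \oA f).

Section CoAlgebra.
Variable R : comPzRingType.
Implicit Types A B C : comPzAlgType R.

Definition co_ops A := forall w : alg_op R, algHom A (tensor A (arity w)).

(* The co-operation attached to a term: the term with the arrows reversed. *)
Fixpoint coeval A (co : co_ops A) n (s : term R 'I_n) : algHom A (tensor A n) :=
  match s with
  | Var i => tensor_inj A i
  | App w a => copair (fun j => coeval co (a j)) \oA co w
  end.

Record coAlgStr A := CoAlgStr {
  coop : co_ops A;
  coop_identity : forall n (s t : term R 'I_n),
    alg_identity s t -> coeval coop s = coeval coop t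
}.

Record coAlg := CoAlg {
  coalg_carrier :> comPzAlgType R;
  coalg_str :> coAlgStr coalg_carrier
}.

Definition coalg_morphism (S T : coAlg) (f : algHom S T) : Prop :=
  forall w, coop T w \oA f = tensor_map (arity w) f \oA coop S w.

Record coHom (S T : coAlg) := CoHom {
  cohom_fun :> algHom S T;
  cohomP : coalg_morphism cohom_fun
}.

Lemma compHomA A B C D (h : algHom C D) (g : algHom B C) (f : algHom A B) :
  h \oA (g \oA f) = (h \oA g) \oA f.
Proof. exact: algHom_eq. Qed.

Lemma comp_copair n A B C (g : algHom B C) (f : 'I_n -> algHom A B) :
  g \oA copair f = copair (fun i => g \oA f i).
Proof.
apply: tensor_hom_eq => i; apply: algHom_eq => x.
by rewrite -[LHS]/(g (copair f (tensor_inj A i x))) -[RHS]/(copair _ _)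
  !copair_inj.
Qed.

Lemma copair_comp_inj n A B (f : 'I_n -> algHom A B) i :
  copair f \oA tensor_inj A i = f i.
Proof. by apply: algHom_eq => x; exact: copair_inj. Qed.

Lemma copair_id n A : copair (tensor_inj A (n := n)) = idHom _.
Proof.
apply: tensor_hom_eq => i; rewrite copair_comp_inj; exact: algHom_eq.
Qed.

Fact idCo_proof (T : coAlg) : coalg_morphism (idHom T).
Proof.
move=> w; rewrite /tensor_map [X in copair X](_ : _ = tensor_inj T (n := _)).
  by rewrite copair_id; exact: algHom_eq.
by apply/funext => i; exact: algHom_eq.
Qed.
Definition idCo (T : coAlg) : coHom T T := CoHom (@idCo_proof T).

Fact compCo_proof (S T U : coAlg) (g : coHom T U) (f : coHom S T) :
  coalg_morphism (g \oA f).
Proof.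
move=> w; rewrite compHomA (cohomP g) -compHomA (cohomP f) compHomA.
congr (_ \oA _); rewrite /tensor_map comp_copair; congr copair.
by apply/funext => i; rewrite compHomA copair_comp_inj compHomA.
Qed.
Definition compCo (S T U : coAlg) (g : coHom T U) (f : coHom S T) :
  coHom S U := CoHom (compCo_proof g f).

Lemma coHom_eq (S T : coAlg) (f g : coHom S T) : f =1 g -> f = g.
Proof.
case: f g => [f fP] [g gP] /= /algHom_eq fg; subst g.
by rewrite (Prop_irrelevance fP gP).
Qed.

Definition homset (T : coAlg) B : Type := algHom T B.

Section HomB.
Variables (T : coAlg) (B : comPzAlgType R).
Local Notation H := (homset T B).

HB.instance Definition _ := gen_eqMixin H.
HB.instance Definition _ := gen_choiceMixin H.

Definition hom_op_eval w (f : 'I_(arity w) -> H) : H := copair f \oA coop T w.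

Fixpoint hom_term n (f : 'I_n -> H) (s : term R 'I_n) : H :=
  match s with
  | Var i => f i
  | App w a => hom_op_eval (fun j => hom_term f (a j))
  end.

Fact hom_termE n (f : 'I_n -> H) s :
  hom_term f s = copair f \oA coeval (coop T) s.
Proof.
elim: s => [i | w a IH] /=; first by rewrite copair_comp_inj.
rewrite compHomA comp_copair /hom_op_eval; congr (copair _ \oA _).
by apply/funext => j; exact: IH.
Qed.

Fact hom_identity n (f : 'I_n -> H) s t :
  alg_identity s t -> hom_term f s = hom_term f t.
Proof. by move=> st; rewrite !hom_termE (coop_identity _ st). Qed.

Definition hom0 : H := @hom_op_eval OpZero (tnth [tuple]).
Definition hom1 : H := @hom_op_eval OpOne (tnth [tuple]).
Definition homN (f : H) : H := @hom_op_eval OpOpp (tnth [tuple f]).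
Definition homD (f g : H) : H := @hom_op_eval OpAdd (tnth [tuple f; g]).
Definition homM (f g : H) : H := @hom_op_eval OpMul (tnth [tuple f; g]).
Definition homZ (a : R) (f : H) : H :=
  @hom_op_eval (OpScale a) (tnth [tuple f]).

Let t0 n : term R 'I_n := App (w := OpZero) (tnth [tuple]).
Let t1 n : term R 'I_n := App (w := OpOne) (tnth [tuple]).
Let tN n (s : term R 'I_n) := App (w := OpOpp) (tnth [tuple s]).
Let tD n (s t : term R 'I_n) := App (w := OpAdd) (tnth [tuple s; t]).
Let tM n (s t : term R 'I_n) := App (w := OpMul) (tnth [tuple s; t]).
Let tZ n (a : R) (s : term R 'I_n) := App (w := OpScale a) (tnth [tuple s]).

Let hom_t0 n (f : 'I_n -> H) : hom_term f (t0 n) = hom0.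
Proof. by congr hom_op_eval; apply/funext => -[]. Qed.
Let hom_t1 n (f : 'I_n -> H) : hom_term f (t1 n) = hom1.
Proof. by congr hom_op_eval; apply/funext => -[]. Qed.
Let hom_tN n (f : 'I_n -> H) s : hom_term f (tN s) = homN (hom_term f s).
Proof. by congr hom_op_eval; apply/funext => i; rewrite !ord1. Qed.
Let hom_tD n (f : 'I_n -> H) s t :
  hom_term f (tD s t) = homD (hom_term f s) (hom_term f t).
Proof. by congr hom_op_eval; apply/funext => -[[|[|//]] i]. Qed.
Let hom_tM n (f : 'I_n -> H) s t :
  hom_term f (tM s t) = homM (hom_term f s) (hom_term f t).
Proof. by congr hom_op_eval; apply/funext => -[[|[|//]] i]. Qed.
Let hom_tZ n (f : 'I_n -> H) a s : hom_term f (tZ a s) = homZ a (hom_term f s).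
Proof. by congr hom_op_eval; apply/funext => i; rewrite !ord1. Qed.
Let hom_tE := (hom_t0, hom_t1, hom_tN, hom_tD, hom_tM, hom_tZ).

Let x0 {n} : term R 'I_n.+1 := Var R (@Ordinal n.+1 0 isT).
Let x1 {n} : term R 'I_n.+2 := Var R (@Ordinal n.+2 1 isT).
Let x2 {n} : term R 'I_n.+3 := Var R (@Ordinal n.+3 2 isT).

Fact homDA : associative homD.
Proof.
move=> f g h.
have := @hom_identity 3 (tnth [tuple f; g; h]) (tD x0 (tD x1 x2))
  (tD (tD x0 x1) x2).
by rewrite !hom_tE; apply=> A v; exact: addrA.
Qed.

Fact homDC : commutative homD.
Proof.
move=> f g; have := @hom_identity 2 (tnth [tuple f; g]) (tD x0 x1) (tD x1 x0).
by rewrite !hom_tE; apply=> A v; exact: addrC.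
Qed.

Fact hom0D : left_id hom0 homD.
Proof.
move=> f; have := @hom_identity 1 (tnth [tuple f]) (tD (t0 1) x0) x0.
by rewrite !hom_tE; apply=> A v; exact: add0r.
Qed.

Fact homND : left_inverse hom0 homN homD.
Proof.
move=> f; have := @hom_identity 1 (tnth [tuple f]) (tD (tN x0) x0) (t0 1).
by rewrite !hom_tE; apply=> A v; exact: addNr.
Qed.

HB.instance Definition _ := GRing.isZmodule.Build H homDA homDC hom0D homND.

Fact homMA : associative homM.
Proof.
move=> f g h.
have := @hom_identity 3 (tnth [tuple f; g; h]) (tM x0 (tM x1 x2))
  (tM (tM x0 x1) x2).
by rewrite !hom_tE; apply=> A v; exact: mulrA.
Qed.

Fact homMC : commutative homM.
Proof.
move=> f g; have := @hom_identity 2 (tnth [tuple f; g]) (tM x0 x1) (tM x1 x0).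
by rewrite !hom_tE; apply=> A v; exact: mulrC.
Qed.

Fact hom1M : left_id hom1 homM.
Proof.
move=> f; have := @hom_identity 1 (tnth [tuple f]) (tM (t1 1) x0) x0.
by rewrite !hom_tE; apply=> A v; exact: mul1r.
Qed.

Fact homMD : left_distributive homM homD.
Proof.
move=> f g h.
have := @hom_identity 3 (tnth [tuple f; g; h]) (tM (tD x0 x1) x2)
  (tD (tM x0 x2) (tM x1 x2)).
by rewrite !hom_tE; apply=> A v; exact: mulrDl.
Qed.

HB.instance Definition _ :=
  GRing.Zmodule_isComPzRing.Build H homMA homMC hom1M homMD.

Definition hom_algmap (a : R) : H := homZ a hom1.

Fact hom_algmap_zmod : zmod_morphism hom_algmap.
Proof.
move=> a b; have := @hom_identity 0 (tnth [tuple]) (tZ (a - b) (t1 0))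
  (tD (tZ a (t1 0)) (tN (tZ b (t1 0)))).
rewrite !hom_tE; apply=> A v.
by rewrite -[LHS]/(algmap (a - b) * 1) rmorphB mulrBl.
Qed.

Fact hom_algmap_monoid : GRing.monoid_morphism hom_algmap.
Proof.
split=> [|a b].
  have := @hom_identity 0 (tnth [tuple]) (tZ 1 (t1 0)) (t1 0).
  rewrite !hom_tE; apply=> A v.
  by rewrite -[LHS]/(algmap 1 * 1) rmorph1 mul1r.
have := @hom_identity 0 (tnth [tuple]) (tZ (a * b) (t1 0))
  (tM (tZ a (t1 0)) (tZ b (t1 0))).
rewrite !hom_tE; apply=> A v.
by rewrite -[LHS]/(algmap (a * b) * 1)
  -[RHS]/((algmap a * 1) * (algmap b * 1)) rmorphM !mulr1.
Qed.

HB.instance Definition _ :=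
  ComPzRing_isAlgebra.Build R H hom_algmap_zmod hom_algmap_monoid.

Lemma hom_opE w (f : 'I_(arity w) -> H) :
  op_eval f = copair f \oA coop T w.
Proof.
rewrite -[RHS]/(hom_op_eval f).
case: w f => [||||| a] f.
- by congr hom_op_eval; apply/funext => -[].
- by congr hom_op_eval; apply/funext => -[].
- rewrite -[LHS]/(homN (f ord0)); congr hom_op_eval.
  by apply/funext => i; rewrite !ord1.
- rewrite -[LHS]/(homD (f ord0) (f ord_max)); congr hom_op_eval.
  by apply/funext => -[[|[|//]] i]; congr f; exact: val_inj.
- rewrite -[LHS]/(homM (f ord0) (f ord_max)); congr hom_op_eval.
  by apply/funext => -[[|[|//]] i]; congr f; exact: val_inj.
- transitivity (homZ a (f ord0)); last first.
    by congr hom_op_eval; apply/funext => i; rewrite !ord1.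
  rewrite -[LHS]/(homM (homZ a hom1) (f ord0)).
  have := @hom_identity 1 f (tM (tZ a (t1 1)) x0) (tZ a x0).
  rewrite !hom_tE /= (_ : Ordinal _ = ord0); last exact: val_inj.
  apply=> A v; rewrite -[LHS]/(algmap a * 1 * v (Ordinal _)).
  by rewrite mulr1.
Qed.

End HomB.

Definition HomB (T : coAlg) B : comPzAlgType R := homset T B.
End CoAlgebra.

Notation "g \oC f" := (compCo g f) (at level 50, left associativity).

Section HomFunctor.
Variable R : comPzRingType.
Implicit Types (A B C : comPzAlgType R) (S T : coAlg R).

Fact HomB_post_op T B C (g : algHom B C) w (f : 'I_(arity w) -> HomB T B) :
  (g \oA op_eval f : HomB T C) = op_eval (fun i => g \oA f i : HomB T C).
Proof. by rewrite !hom_opE compHomA comp_copair. Qed.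

Definition HomB_post T B C (g : algHom B C) : algHom (HomB T B) (HomB T C) :=
  @opHom R (HomB T B) (HomB T C) (fun f => g \oA f)
    (fun w => @HomB_post_op T B C g w).

Fact HomB_pre_op S T B (h : coHom S T) w (f : 'I_(arity w) -> HomB T B) :
  (op_eval f \oA h : HomB S B) = op_eval (fun i => f i \oA h : HomB S B).
Proof.
rewrite !hom_opE -compHomA (cohomP h) compHomA comp_copair.
congr (copair _ \oA _); apply/funext => i.
by rewrite compHomA copair_comp_inj.
Qed.

Definition HomB_pre S T B (h : coHom S T) : algHom (HomB T B) (HomB S B) :=
  @opHom R (HomB T B) (HomB S B) (fun f => f \oA h)
    (fun w => @HomB_pre_op S T B h w).

End HomFunctor.

Section Odot.
Variable R : comPzRingType.
Implicit Types (A B C : comPzAlgType R).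

Section OdotAlg.
Variables (A : comPzAlgType R) (T : coAlg R).

(* [odot] is the Tall-Wraith product: [pres] applied to the assignments where *)
(* [v (a, t)] is the value at [t] of the image of [a] under a morphism        *)
(* [A -> Hom(T, B)].                                                          *)
Definition odot_rel B (v : A * T -> B) : Prop :=
  exists phi : algHom A (HomB T B),
    forall a t, v (a, t) = (phi a : algHom T B) t.

Definition odot : comPzAlgType R := pres odot_rel.
Definition odot_elt (a : A) (t : T) : odot := pres_gen odot_rel (a, t).

Section Lift.
Variables (B : comPzAlgType R) (phi : algHom A (HomB T B)).

Fact odot_lift_proof : odot_rel (fun at_ => (phi at_.1 : algHom T B) at_.2).
Proof. by exists phi. Qed.

Definition odot_lift : algHom odot B := pres_lift odot_lift_proof.

Lemma odot_liftE a t : odot_lift (odot_elt a t) = (phi a : algHom T B) t.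
Proof. exact: pres_lift_gen. Qed.

End Lift.

Lemma odot_sep (x y : odot) :
  (forall B (phi : algHom A (HomB T B)), odot_lift phi x = odot_lift phi y) ->
  x = y.
Proof.
move=> xy; apply: pres_lift_sep => B v okv; have [phi vE] := okv.
suff -> : pres_lift okv = odot_lift phi by exact: xy.
by apply: pres_hom_eq => -[a t]; rewrite [RHS]odot_liftE pres_lift_gen vE.
Qed.

Fact odot_elt_proof a : alg_morphism (odot_elt a).
Proof.
apply: op_hom => w x; apply: odot_sep => B phi.
rewrite hom_op odot_liftE (hom_op (phi a : algHom T B)); congr op_eval.
by apply/funext => i; rewrite odot_liftE.
Qed.

Definition odot_eltHom a : HomB T odot := AlgHom (odot_elt_proof a).

Fact odot_univ_op w (x : 'I_(arity w) -> A) :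
  odot_eltHom (op_eval x) = op_eval (fun i => odot_eltHom (x i)).
Proof.
apply: algHom_eq => t; apply: odot_sep => B phi.
transitivity ((phi (op_eval x) : algHom T B) t); first exact: odot_liftE.
rewrite -[RHS]/((HomB_post T (odot_lift phi)
  (op_eval (fun i => odot_eltHom (x i))) : algHom T B) t) hom_op hom_op.
congr (((op_eval _ : HomB T B) : algHom T B) t); apply/funext => i.
by apply: algHom_eq => u; symmetry; exact: odot_liftE.
Qed.

Definition odot_univ : algHom A (HomB T odot) := opHom odot_univ_op.

Definition odot_curry B (g : algHom odot B) : algHom A (HomB T B) :=
  HomB_post T g \oA odot_univ.

Lemma odot_curryK B : cancel (@odot_curry B) (@odot_lift B).
Proof. by move=> g; apply: pres_hom_eq => -[a t]; rewrite [LHS]odot_liftE. Qed.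

Lemma odot_liftK B : cancel (@odot_lift B) (@odot_curry B).
Proof.
move=> phi; apply: algHom_eq => a; apply: algHom_eq => t.
exact: odot_liftE.
Qed.

End OdotAlg.

Section OdotCoAlg.
Variables T1 T2 : coAlg R.
Local Notation P := (odot T1 T2).

(* The co-operation is the value of the operation of                          *)
(* [Hom(T1, Hom(T2, P (x) ... (x) P))] at the coprojections.                  *)
Definition odot_coop : co_ops P := fun w =>
  odot_lift (op_eval (fun i => odot_curry (tensor_inj P (n := arity w) i)
    : HomB T1 (HomB T2 (tensor P (arity w))))).

Fact odot_curry_comp B C (g : algHom B C) (f : algHom P B) :
  odot_curry (g \oA f) = HomB_post T2 g \oA odot_curry f.
Proof. by apply: algHom_eq => a; apply: algHom_eq => t. Qed.

Fact odot_curry_op w B (f : 'I_(arity w) -> algHom P B) :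
  odot_curry (copair f \oA odot_coop w)
    = op_eval (fun i => odot_curry (f i) : HomB T1 (HomB T2 B))
      :> HomB T1 (HomB T2 B).
Proof.
rewrite odot_curry_comp odot_liftK.
rewrite -[LHS]/(HomB_post T1 (HomB_post T2 (copair f)) _) hom_op.
congr op_eval; apply/funext => i.
rewrite -[LHS]/(HomB_post T2 (copair f) \oA odot_curry (tensor_inj P i)).
by rewrite -odot_curry_comp copair_comp_inj.
Qed.

Fact odot_coeval n (s : term R 'I_n) :
  odot_curry (coeval odot_coop s)
    = eval (fun i => odot_curry (tensor_inj P i)
        : HomB T1 (HomB T2 (tensor P n))) s
      :> HomB T1 (HomB T2 (tensor P n)).
Proof.
elim: s => [//|w a IH] /=; rewrite odot_curry_op; congr op_eval.
by apply/funext => j; exact: IH.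
Qed.

Fact odot_coop_identity n (s t : term R 'I_n) :
  alg_identity s t -> coeval odot_coop s = coeval odot_coop t.
Proof.
move=> st; apply: (can_inj (@odot_curryK T1 T2 _)).
rewrite !odot_coeval; exact: (st (HomB T1 (HomB T2 (tensor P n)))).
Qed.

Definition odotC : coAlg R := CoAlg (CoAlgStr odot_coop_identity).

Fact odot_hom_op B w (f : 'I_(arity w) -> HomB odotC B) :
  odot_curry (op_eval f) = op_eval (fun i => odot_curry (f i)
    : HomB T1 (HomB T2 B)).
Proof. by rewrite hom_opE odot_curry_op. Qed.

(* Bijective by [odot_curryK] and [odot_liftK].                               *)
Definition odot_adj B : algHom (HomB odotC B) (HomB T1 (HomB T2 B)) :=
  @opHom _ (HomB odotC B) (HomB T1 (HomB T2 B)) (@odot_curry T1 T2 B)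
    (@odot_hom_op B).

End OdotCoAlg.

Fact odot_adj_inj (T1 T2 : coAlg R) B : injective (odot_adj T1 T2 B).
Proof. exact: can_inj (@odot_curryK T1 T2 B). Qed.

(* Yoneda: a morphism is a co-algebra morphism as soon as precomposition with *)
(* it preserves the operations of [Hom(-, B)], here tested after an injective *)
(* morphism [J].                                                              *)
Lemma cohom_yoneda (S T : coAlg R) (g : algHom S T) :
  (forall B, exists C (J : algHom (HomB S B) C) (Phi : algHom (HomB T B) C),
     injective J /\ forall f : algHom T B, J (f \oA g) = Phi f) ->
  coalg_morphism g.
Proof.
move=> gP w; have [C [J [Phi [Jinj JPhi]]]] := gP (tensor T (arity w)).
pose x i : HomB T _ := tensor_inj T (n := arity w) i.
have coE : coop T w = op_eval x.
  by rewrite hom_opE copair_id; exact: algHom_eq.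
have mapE : tensor_map (arity w) g \oA coop S w
    = op_eval (fun i => x i \oA g : HomB S (tensor T (arity w))).
  by rewrite hom_opE.
apply: Jinj; rewrite JPhi coE mapE !hom_op; congr op_eval.
by apply/funext => i; rewrite JPhi.
Qed.

Section OdotMap.

Definition odot_map (A A' : comPzAlgType R) (T T' : coAlg R)
    (f : algHom A A') (h : coHom T T') : algHom (odot A T) (odot A' T') :=
  odot_lift (HomB_pre (odot A' T') h \oA odot_univ A' T' \oA f).

Lemma odot_mapE A A' (T T' : coAlg R) (f : algHom A A') (h : coHom T T') a t :
  odot_map f h (odot_elt a t) = odot_elt (f a) (h t).
Proof. exact: odot_liftE. Qed.

Variables (S S' T T' : coAlg R) (f : coHom S S') (h : coHom T T').

Fact odot_map_proof :
  coalg_morphism (odot_map f h : algHom (odotC S T) (odotC S' T')).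
Proof.
apply: cohom_yoneda => B; exists (HomB S (HomB T B)), (odot_adj S T B).
exists (HomB_pre _ f \oA HomB_post S' (HomB_pre B h) \oA odot_adj S' T' B).
split=> [|G]; first exact: odot_adj_inj.
apply: algHom_eq => s; apply: algHom_eq => t.
by rewrite -[LHS]/(G (odot_map f h (odot_elt s t))) odot_mapE.
Qed.

Definition odot_mapC : coHom (odotC S T) (odotC S' T') :=
  CoHom odot_map_proof.

End OdotMap.

Section OdotAssoc.
Variables T1 T2 T3 : coAlg R.

Definition odot_assoc :
    algHom (odot (odotC T1 T2) T3) (odot T1 (odotC T2 T3)) :=
  odot_lift (odot_lift (odot_adj T2 T3 _ \oA odot_univ T1 (odotC T2 T3))).

Lemma odot_assocE t1 t2 t3 :
  odot_assoc (odot_elt (odot_elt t1 t2 : odotC T1 T2) t3)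
    = odot_elt t1 (odot_elt t2 t3 : odotC T2 T3).
Proof. by rewrite odot_liftE odot_liftE. Qed.

Fact odot_assoc_proof : coalg_morphism
  (odot_assoc : algHom (odotC (odotC T1 T2) T3) (odotC T1 (odotC T2 T3))).
Proof.
apply: cohom_yoneda => B; exists (HomB T1 (HomB T2 (HomB T3 B))).
exists (odot_adj T1 T2 (HomB T3 B) \oA odot_adj (odotC T1 T2) T3 B).
exists (HomB_post T1 (odot_adj T2 T3 B) \oA odot_adj T1 (odotC T2 T3) B).
split=> [|G]; first by apply: inj_comp; exact: odot_adj_inj.
apply: algHom_eq => t1; apply: algHom_eq => t2; apply: algHom_eq => t3.
by rewrite -[RHS]/(G (odot_elt t1 (odot_elt t2 t3 : odotC T2 T3)))
  -odot_assocE.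
Qed.

Definition odot_assocC :
    coHom (odotC (odotC T1 T2) T3) (odotC T1 (odotC T2 T3)) :=
  CoHom odot_assoc_proof.

End OdotAssoc.

(* The free algebra on one generator, that is [R[x]]; the library's           *)
(* [{poly R}] requires [R] to be nonzero.                                     *)
Definition polyalg : comPzAlgType R :=
  pres (fun (B : comPzAlgType R) (_ : unit -> B) => True).
Definition polyalgX : polyalg := pres_gen _ tt.

Definition polyalg_lift B (b : B) : algHom polyalg B :=
  @pres_lift R unit _ B (fun=> b) Logic.I.

Lemma polyalg_liftE B (b : B) : polyalg_lift b polyalgX = b.
Proof. exact: pres_lift_gen. Qed.

Lemma polyalg_hom_eq B (f g : algHom polyalg B) :
  f polyalgX = g polyalgX -> f = g.
Proof. by move=> fg; apply: pres_hom_eq => -[]. Qed.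

Definition polyalg_coop : co_ops polyalg := fun w =>
  polyalg_lift (op_eval (fun i =>
    tensor_inj polyalg (n := arity w) i polyalgX)).

Fact polyalg_coeval n (s : term R 'I_n) :
  coeval polyalg_coop s polyalgX
    = eval (fun i => tensor_inj polyalg i polyalgX) s.
Proof.
elim: s => [//|w a IH] /=; rewrite -[LHS]/(copair _ (polyalg_coop w polyalgX)).
rewrite polyalg_liftE hom_op; congr op_eval.
by apply/funext => j; rewrite copair_inj; exact: IH.
Qed.

Fact polyalg_coop_identity n (s t : term R 'I_n) :
  alg_identity s t -> coeval polyalg_coop s = coeval polyalg_coop t.
Proof. by move=> st; apply: polyalg_hom_eq; rewrite !polyalg_coeval st. Qed.

Definition unitI : coAlg R := CoAlg (CoAlgStr polyalg_coop_identity).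

Fact unitI_hom_op B w (b : 'I_(arity w) -> B) :
  (polyalg_lift (op_eval b) : HomB unitI B)
    = op_eval (fun i => polyalg_lift (b i) : HomB unitI B) :> HomB unitI B.
Proof.
rewrite hom_opE; apply: polyalg_hom_eq; rewrite polyalg_liftE.
rewrite -[RHS]/(copair _ (polyalg_coop w polyalgX)) polyalg_liftE hom_op.
by congr op_eval; apply/funext => i; rewrite copair_inj polyalg_liftE.
Qed.

Definition unitI_adj B : algHom B (HomB unitI B) :=
  @opHom R B (HomB unitI B) (@polyalg_lift B) (fun w => @unitI_hom_op B w).

Section OdotUnit.
Variable T : coAlg R.

Definition odot_unitl : algHom (odot unitI T) T :=
  odot_lift (polyalg_lift (idHom T : HomB T T)).

Lemma odot_unitlE t : odot_unitl (odot_elt polyalgX t) = t.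
Proof. by rewrite odot_liftE polyalg_liftE. Qed.

Fact odot_unitl_proof :
  coalg_morphism (odot_unitl : algHom (odotC unitI T) T).
Proof.
apply: cohom_yoneda => B; exists (HomB unitI (HomB T B)), (odot_adj unitI T B).
exists (unitI_adj (HomB T B)); split=> [|G]; first exact: odot_adj_inj.
apply: polyalg_hom_eq; rewrite polyalg_liftE; apply: algHom_eq => t.
by rewrite -[LHS]/(G (odot_unitl (odot_elt polyalgX t))) odot_unitlE.
Qed.

Definition odot_unitlC : coHom (odotC unitI T) T := CoHom odot_unitl_proof.

Definition odot_unitr : algHom (odot T unitI) T := odot_lift (unitI_adj T).

Lemma odot_unitrE t : odot_unitr (odot_elt t (polyalgX : unitI)) = t.
Proof. by rewrite odot_liftE polyalg_liftE. Qed.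

Fact odot_unitr_proof :
  coalg_morphism (odot_unitr : algHom (odotC T unitI) T).
Proof.
apply: cohom_yoneda => B; exists (HomB T (HomB unitI B)), (odot_adj T unitI B).
exists (HomB_post T (unitI_adj B)); split=> [|G]; first exact: odot_adj_inj.
apply: algHom_eq => t; apply: polyalg_hom_eq.
rewrite [RHS]polyalg_liftE.
by rewrite -[LHS]/(G (odot_unitr (odot_elt t (polyalgX : unitI)))) odot_unitrE.
Qed.

Definition odot_unitrC : coHom (odotC T unitI) T := CoHom odot_unitr_proof.

End OdotUnit.

End Odot.

Section Monoids.
Variable R : comPzRingType.

Record twMonoidStr (T : coAlg R) := TwMonoidStr {
  tw_mul : coHom (odotC T T) T;
  tw_one : coHom (unitI R) T;
  tw_mulA : tw_mul \oC odot_mapC tw_mul (idCo T)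
    = tw_mul \oC odot_mapC (idCo T) tw_mul \oC odot_assocC T T T;
  tw_mul1l : tw_mul \oC odot_mapC tw_one (idCo T) = odot_unitlC T;
  tw_mul1r : tw_mul \oC odot_mapC (idCo T) tw_one = odot_unitrC T
}.

Section Modules.
Variables (T : coAlg R) (M : twMonoidStr T).

Record twModStr (B : comPzAlgType R) := TwModStr {
  tw_act : algHom B (HomB T B);
  tw_actA : HomB_post T tw_act \oA tw_act
    = odot_adj T T B \oA HomB_pre B (tw_mul M) \oA tw_act;
  tw_act1 : HomB_pre B (tw_one M) \oA tw_act = unitI_adj B
}.

Record twModule := TwModule {
  twmod_alg :> comPzAlgType R;
  twmod_str :> twModStr twmod_alg
}.

Record twModHom (B C : twModule) := TwModHom {
  twmod_fun :> algHom B C;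
  twmod_funP : tw_act C \oA twmod_fun = HomB_post T twmod_fun \oA tw_act B
}.

Fact idMod_proof (B : twModule) :
  tw_act B \oA idHom B = HomB_post T (idHom B) \oA tw_act B.
Proof. by apply: algHom_eq => b; apply: algHom_eq. Qed.
Definition idMod B : twModHom B B := TwModHom (idMod_proof B).

Fact compMod_proof (B C D : twModule) (g : twModHom C D) (f : twModHom B C) :
  tw_act D \oA (g \oA f) = HomB_post T (g \oA f) \oA tw_act B.
Proof.
rewrite compHomA twmod_funP -compHomA twmod_funP compHomA.
by congr (_ \oA _); apply: algHom_eq => h; exact: algHom_eq.
Qed.
Definition compMod B C D (g : twModHom C D) (f : twModHom B C) :
  twModHom B D := TwModHom (compMod_proof g f).

End Modules.
End Monoids.

Section SetHom.
Variable R : comPzRingType.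

Section Pre.
Variables (X Y : Type) (h : X -> Y).

Fact setHom_pre_proof :
  alg_morphism (fun phi : setHom R Y => phi \o h : setHom R X).
Proof. by []. Qed.

Definition setHom_pre : algHom (setHom R Y) (setHom R X) :=
  AlgHom setHom_pre_proof.

End Pre.

(* The canonical map from the tensor power of [R^R] to [Hom_Set(|R|^n, R)],   *)
(* sending [f_1 (x) ... (x) f_n] to [r |-> f_1 r_1 * ... * f_n r_n].          *)
Definition tensor_can n :
    algHom (tensor (setHom R R) n) (setHom R ('I_n -> R)) :=
  copair (fun i => setHom_pre (fun r : 'I_n -> R => r i)).

End SetHom.

(* Main.v *)
(* Since [R] is finite, the pure tensors e_s = d_(s 1) (x) ... (x) d_(s n) of
   indicator functions sum to 1 in the tensor power of [R^R], and
   x e_s = can(x)(s) e_s for every tensor x; so the canonical map is bijective,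
   with inverse g |-> sum_s g(s) e_s.  The co-operations transport the
   operations of [R], so they satisfy the same identities, and for this
   structure phi |-> (f |-> f o phi) is an algebra morphism
   [Hom_Set(X, R) -> Hom(R^R, Hom_Set(X, R))].  This morphism is the action,
   its case X = R induces the multiplication, and the remaining equations are
   checked on the generators of the Tall-Wraith products. *)
Require Import Defs.
From HB Require Import structures.
From mathcomp Require Import all_boot all_order all_algebra.
From mathcomp Require Import boolp functions.

Set Implicit Arguments.
Unset Strict Implicit.
Unset Printing Implicit Defensive.

Import GRing.Theory.
Local Open Scope ring_scope.

(** * Morphisms out of presented algebras *)

Section AlgHomTheory.
Variable R : comPzRingType.
Implicit Types A B : comPzAlgType R.

Lemma algHom_inv A B (f : algHom A B) (g : B -> A) :
  cancel f g -> cancel g f -> alg_morphism g.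
Proof.
move=> fK gK; apply: op_hom => w x; apply: (can_inj fK).
by rewrite gK hom_op; congr op_eval; apply/funext => i; rewrite gK.
Qed.

(** Each element is the class of a term, and that class is the term evaluated at the generators, so
    induction on terms applies. *)
Lemma pres_ind G (ok : forall B : comPzAlgType R, (G -> B) -> Prop)
    (P : pres ok -> Prop) :
  (forall x, P (pres_gen ok x)) ->
  (forall w (x : 'I_(arity w) -> pres ok),
     (forall i, P (x i)) -> P (op_eval x)) ->
  forall x, P x.
Proof.
move=> Pgen Pop x; rewrite -[x]reprK -pres_eval_gen.
by elim: (repr x) => //= w a IH; apply: Pop.
Qed.

(** Reduces an equation between morphisms on a Tall-Wraith product to the elements [odot_elt a t];
    used twice, it covers triple products. *)
Lemma odot_hom_eq A (T : coAlg R) B (f g : algHom (odot A T) B) :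
  odot_curry f = odot_curry g -> f = g.
Proof. exact: can_inj (@odot_curryK R A T B) _ _. Qed.

Lemma algHom_sum A B (f : algHom A B) I (F : I -> A) (r : seq I) :
  f (\sum_(i <- r) F i) = \sum_(i <- r) f (F i).
Proof.
have [fD _ _] := alg_funP f; apply: (big_morph f fD).
exact: (@hom_op R A B f OpZero (fun=> 0)).
Qed.

Lemma setHom_op X w (x : 'I_(arity w) -> setHom R X) (r : X) :
  op_eval x r = @op_eval R R^o w (fun i => x i r).
Proof. by case: w x. Qed.

End AlgHomTheory.

Lemma twModHom_eq (R : comPzRingType) (T : coAlg R) (M : twMonoidStr T)
  (B C : twModule M) (f g : twModHom B C) : f =1 g -> f = g.
Proof.
case: f g => [f fP] [g gP] /= /algHom_eq fg; subst g.
by rewrite (Prop_irrelevance fP gP).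
Qed.

Section FunctionAlgebra.
Variable R : finComPzRingType.
Local Notation RR := (setHom R R).

(** * Tensor powers of [R^R] as function algebras *)

Section TensorPower.
Variable n : nat.

Let delta (r : R) : RR := fun x => (x == r)%:R.
Let basis (s : 'I_n -> R) : tensor RR n := pure (fun i => delta (s i)).

Lemma tensor_can_pure (tau : 'I_n -> RR) r :
  tensor_can R n (pure tau) r = \prod_i tau i (r i).
Proof. by rewrite copair_pure fct_prodE. Qed.

Let sum_delta : \sum_r delta r = 1.
Proof.
apply/funext => x; rewrite fct_sumE (bigD1 x) //= /delta eqxx big1 ?addr0 //.
by move=> r /negbTE; rewrite eq_sym => ->.
Qed.

Let sum_basis : \sum_(s : {ffun 'I_n -> R}) basis s = 1.
Proof.
have [_ _ [p1 _]] := pure_rel RR n.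
under eq_bigr => s _ do rewrite /basis pure_prod.
(* Distributivity turns the sum over all [s] into a product over [i] of sums over [r], and each of
   these is the image of [sum_delta]. *)
rewrite -(bigA_distr_bigA (fun i r => tensor_inj RR i (delta r))).
apply: big1 => i _; rewrite -algHom_sum sum_delta.
by have [_ [-> _] _] := alg_funP (tensor_inj RR i).
Qed.

(** On a pure tensor this is [f * delta r = f(r) *a delta r] in each factor. It passes to all
    tensors because the canonical map followed by evaluation at [s] preserves the operations. *)
Let mul_basis (x : tensor RR n) s :
  x * basis s = (tensor_can R n x s) *a basis s.
Proof.
elim/pres_ind: x => [tau | w x IH].
  rewrite /basis -/(pure tau) tensor_can_pure !pure_prod -big_split rmorph_prod.
  rewrite -big_split; apply: eq_bigr => i _ /=.
  have [_ [_ iM] iZ] := alg_funP (tensor_inj RR i).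
  rewrite -iZ -iM; congr (tensor_inj RR i _); apply/funext => y.
  rewrite -[LHS]/(tau i y * delta (s i) y).
  rewrite -[RHS]/(tau i (s i) * delta (s i) y) /delta.
  by case: eqP => [-> //|_]; rewrite !mulr0.
rewrite hom_op setHom_op; case: w x IH => [||||| a] x IH /=.
- by rewrite rmorph0 !mul0r.
- by rewrite rmorph1 !mul1r.
- by rewrite rmorphN !mulNr IH.
- by rewrite rmorphD !mulrDl !IH.
- by rewrite rmorphM -!mulrA IH mulrCA IH mulrCA.
- by rewrite rmorphM -!mulrA IH.
Qed.

Definition tensor_uncan (g : setHom R ('I_n -> R)) : tensor RR n :=
  \sum_(s : {ffun 'I_n -> R}) (g s) *a basis s.

Lemma tensor_canK : cancel (tensor_can R n) tensor_uncan.
Proof.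
move=> x; rewrite -[RHS]mulr1 -sum_basis mulr_sumr.
by apply: eq_bigr => s _; exact: esym (mul_basis _ _).
Qed.

Lemma tensor_uncanK : cancel tensor_uncan (tensor_can R n).
Proof.
move=> g; apply/funext => r; rewrite algHom_sum fct_sumE.
have [_ _ canZ] := alg_funP (tensor_can R n).
have term s : tensor_can R n ((g s) *a basis s) r
    = g s * \prod_i (r i == s i)%:R.
  by rewrite canZ -[LHS]/(g s * tensor_can R n (basis s) r) tensor_can_pure.
under eq_bigr => s _ do rewrite term.
(* Only the summand with [s] equal to [r] survives: any other [s] differs from [r] at some [i],
   where the indicator vanishes. *)
rewrite (bigD1 [ffun i => r i]) //= [X in g X](_ : _ = r); last first.
  by apply/funext => i; rewrite ffunE.
rewrite [X in g r * X]big1 => [|i _]; last by rewrite ffunE eqxx.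
rewrite mulr1 [X in _ + X]big1 ?addr0 // => s /eqP sr.
case: (pselect (exists i, r i != s i)) => [[i ri] | nri].
  by rewrite (bigD1 i) //= (negbTE ri) mul0r mulr0.
case: sr; apply/ffunP => i; rewrite ffunE; apply/eqP/negPn/negP => si.
by apply: nri; exists i; rewrite eq_sym.
Qed.

Lemma tensor_can_bij : bijective (tensor_can R n).
Proof. exact: Bijective tensor_canK tensor_uncanK. Qed.

Definition tensor_uncanHom : algHom (setHom R ('I_n -> R)) (tensor RR n) :=
  AlgHom (algHom_inv tensor_canK tensor_uncanK).

End TensorPower.

(** * The co-algebra structure on [R^R] *)

Definition funcoop : co_ops RR := fun w =>
  tensor_uncanHom (arity w) \oA setHom_pre R (@op_eval R R^o w).

Lemma tensor_can_funcoop w :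
  tensor_can R (arity w) \oA funcoop w = setHom_pre R (@op_eval R R^o w).
Proof. by apply: algHom_eq => f; apply: tensor_uncanK. Qed.

(** Both sides agree on each coprojection. Operations of [Hom(R^R, R^X)] on such morphisms thereby
    pass through the canonical map, where the co-operations are known. *)
Lemma copair_setHom_pre n X (phi : 'I_n -> setHom R X) :
  copair (fun i => setHom_pre R (phi i))
    = setHom_pre R (fun x i => phi i x) \oA tensor_can R n.
Proof.
apply: tensor_hom_eq => i; rewrite -compHomA !copair_comp_inj.
exact: algHom_eq.
Qed.

(** Terms with equal values in [R] thus have equal co-operations, the canonical map being
    injective. *)
Lemma tensor_can_coeval n (s : term R 'I_n) :
  tensor_can R n \oA coeval funcoop s
    = setHom_pre R (fun v : 'I_n -> R => eval (v : 'I_n -> R^o) s).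
Proof.
elim: s => [i | w a IH] /=; first by rewrite copair_comp_inj.
rewrite compHomA comp_copair.
under [fun i => _]funext => i do rewrite IH.
rewrite copair_setHom_pre -compHomA tensor_can_funcoop.
exact: algHom_eq.
Qed.

Fact funcoop_identity n (s t : term R 'I_n) :
  alg_identity s t -> coeval funcoop s = coeval funcoop t.
Proof.
move=> st; apply: algHom_eq => f; apply: (can_inj (@tensor_canK n)).
rewrite -[LHS]/((tensor_can R n \oA coeval funcoop s) f).
rewrite -[RHS]/((tensor_can R n \oA coeval funcoop t) f) !tensor_can_coeval.
by apply/funext => v /=; rewrite st.
Qed.

Definition funStr : coAlgStr RR := CoAlgStr funcoop_identity.
Definition funCo : coAlg R := CoAlg funStr.

(** * The action of [R^R] on function algebras *)

Section Action.
Variable X : Type.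

Fact fun_act_op w (phi : 'I_(arity w) -> setHom R X) :
  (setHom_pre R (op_eval phi) : HomB funCo (setHom R X))
    = op_eval (fun i => setHom_pre R (phi i) : HomB funCo (setHom R X)).
Proof.
rewrite hom_opE copair_setHom_pre -compHomA tensor_can_funcoop.
apply: algHom_eq => f; apply/funext => x /=.
by congr f; apply: setHom_op.
Qed.

Definition fun_act : algHom (setHom R X) (HomB funCo (setHom R X)) :=
  @opHom R (setHom R X) (HomB funCo (setHom R X)) (fun phi => setHom_pre R phi)
    fun_act_op.

End Action.

(* [R^R] (x) ... (x) [R^R] being itself of the form [setHom R X], compatibility
   with the co-operations may be tested on [Hom(-, setHom R X)], and there only
   on the morphisms given by the action. *)
Lemma coalg_morphism_funCo (S : coAlg R) (g : algHom S funCo) :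
  (forall X, exists C (J : algHom (HomB S (setHom R X)) C)
      (Phi : algHom (setHom R X) C),
     injective J /\ forall phi, J (setHom_pre R phi \oA g) = Phi phi) ->
  coalg_morphism g.
Proof.
move=> gP w; have [C [J [Phi [Jinj JPhi]]]] := gP ('I_(arity w) -> R).
pose pr i : setHom R ('I_(arity w) -> R) := fun r => r i.
suff cancan : tensor_can R (arity w) \oA (coop funCo w \oA g)
    = tensor_can R (arity w) \oA (tensor_map (arity w) g \oA coop S w).
  apply: algHom_eq => x; apply: (can_inj (@tensor_canK _)).
  exact: (congr1 (fun h => alg_fun h x) cancan).
rewrite compHomA tensor_can_funcoop compHomA comp_copair.
under [fun i => _]funext => i do
  rewrite compHomA copair_comp_inj -/(pr i).
(* As a function of its arguments, an operation of [R] is the pointwise operation applied to the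
   coordinate functions. *)
have prE : @op_eval R R^o w = op_eval pr.
  by apply/funext => r; rewrite setHom_op.
rewrite -(hom_opE (fun i => setHom_pre R (pr i) \oA g : HomB S _)) prE.
apply: Jinj; rewrite JPhi !hom_op; congr op_eval.
by apply/funext => i; rewrite JPhi.
Qed.

(** * Multiplication and unit of [R^R], and the monoid laws *)

Definition fun_mulHom : algHom (odot funCo funCo) funCo := odot_lift (fun_act R).

Lemma fun_mulE (f g : funCo) : fun_mulHom (odot_elt f g) = g \o f.
Proof. exact: odot_liftE. Qed.

Fact fun_mul_proof :
  coalg_morphism (fun_mulHom : algHom (odotC funCo funCo) funCo).
Proof.
apply: coalg_morphism_funCo => X.
exists (HomB funCo (HomB funCo (setHom R X))), (odot_adj funCo funCo _).
(* [Phi] acts twice: both sides take [f] and [g] to [g \o f \o phi]. *)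
exists (HomB_post funCo (fun_act X) \oA fun_act X).
split=> [|phi]; first exact: odot_adj_inj.
apply: algHom_eq => f; apply: algHom_eq => g.
by rewrite -[LHS]/(fun_mulHom (odot_elt f g) \o phi) fun_mulE.
Qed.

Definition fun_mul : coHom (odotC funCo funCo) funCo := CoHom fun_mul_proof.

Definition fun_oneHom : algHom (unitI R) funCo :=
  polyalg_lift (id : setHom R R).

Lemma fun_oneE : fun_oneHom (@polyalgX R) = id.
Proof. exact: polyalg_liftE. Qed.

(** Serves twice: it makes the unit a co-algebra morphism, and it is the unit law of the action. *)
Lemma setHom_pre_one X (phi : setHom R X) :
  setHom_pre R phi \oA fun_oneHom = polyalg_lift phi.
Proof.
apply: polyalg_hom_eq; rewrite polyalg_liftE.
by rewrite -[LHS]/(fun_oneHom (@polyalgX R) \o phi) fun_oneE.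
Qed.

Fact fun_one_proof : coalg_morphism fun_oneHom.
Proof.
apply: coalg_morphism_funCo => X.
exists (HomB (unitI R) (setHom R X)), (idHom _), (unitI_adj (setHom R X)).
by split=> // phi; apply: setHom_pre_one.
Qed.

Definition fun_one : coHom (unitI R) funCo := CoHom fun_one_proof.

Fact fun_mulA : fun_mul \oC odot_mapC fun_mul (idCo funCo)
  = fun_mul \oC odot_mapC (idCo funCo) fun_mul
      \oC odot_assocC funCo funCo funCo.
Proof.
suff eqA : fun_mulHom \oA odot_map fun_mulHom (idCo funCo)
    = fun_mulHom \oA odot_map (idHom funCo) fun_mul
        \oA odot_assoc funCo funCo funCo.
  by apply: coHom_eq => x; exact: (congr1 (fun h => alg_fun h x) eqA).
(* On generators [f], [g], [h] both sides are [h \o g \o f]. *)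
apply: odot_hom_eq; apply: odot_hom_eq.
apply: algHom_eq => f; apply: algHom_eq => g; apply: algHom_eq => h.
rewrite -[LHS]/(fun_mulHom (odot_map fun_mulHom (idCo funCo)
  (odot_elt (odot_elt f g : odotC funCo funCo) h))).
rewrite -[RHS]/(fun_mulHom (odot_map (idHom funCo) fun_mul
  (odot_assoc funCo funCo funCo
    (odot_elt (odot_elt f g : odotC funCo funCo) h)))).
by rewrite odot_assocE !odot_mapE !fun_mulE.
Qed.

Fact fun_mul1l :
  fun_mul \oC odot_mapC fun_one (idCo funCo) = odot_unitlC funCo.
Proof.
suff eq1 : fun_mulHom \oA odot_map fun_oneHom (idCo funCo) = odot_unitl funCo.
  by apply: coHom_eq => x; exact: (congr1 (fun h => alg_fun h x) eq1).
apply: odot_hom_eq; apply: polyalg_hom_eq; apply: algHom_eq => f.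
rewrite -[LHS]/(fun_mulHom (odot_map fun_oneHom (idCo funCo)
  (odot_elt (@polyalgX R) f))).
rewrite -[RHS]/(odot_unitl funCo (odot_elt (@polyalgX R) f)).
by rewrite odot_unitlE odot_mapE fun_mulE fun_oneE.
Qed.

Fact fun_mul1r :
  fun_mul \oC odot_mapC (idCo funCo) fun_one = odot_unitrC funCo.
Proof.
suff eq1 : fun_mulHom \oA odot_map (idHom funCo) fun_one = odot_unitr funCo.
  by apply: coHom_eq => x; exact: (congr1 (fun h => alg_fun h x) eq1).
apply: odot_hom_eq; apply: algHom_eq => f; apply: polyalg_hom_eq.
rewrite -[LHS]/(fun_mulHom (odot_map (idHom funCo) fun_one
  (odot_elt f (@polyalgX R : unitI R)))).
rewrite -[RHS]/(odot_unitr funCo (odot_elt f (@polyalgX R : unitI R))).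
by rewrite odot_unitrE odot_mapE fun_mulE fun_oneE.
Qed.

Definition fun_monoid : twMonoidStr funCo :=
  TwMonoidStr fun_mulA fun_mul1l fun_mul1r.

(** * Function algebras as modules, functorially in the set *)

Section Modules.
Variable X : Type.

Fact fun_actA : HomB_post funCo (fun_act X) \oA fun_act X
  = odot_adj funCo funCo _ \oA HomB_pre _ fun_mul \oA fun_act X.
Proof.
apply: algHom_eq => phi; apply: algHom_eq => f; apply: algHom_eq => g.
by rewrite -[RHS]/(fun_mulHom (odot_elt f g) \o phi) fun_mulE.
Qed.

Fact fun_act1 : HomB_pre _ fun_one \oA fun_act X = unitI_adj (setHom R X).
Proof. by apply: algHom_eq => phi; apply: setHom_pre_one. Qed.

Definition fun_mod : twModStr fun_monoid (setHom R X) :=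
  TwModStr (M := fun_monoid) fun_actA fun_act1.

End Modules.

Fact fun_modHom_proof X Y (h : X -> Y) :
  fun_act X \oA setHom_pre R h
    = HomB_post funCo (setHom_pre R h) \oA fun_act Y.
Proof. by apply: algHom_eq => phi; apply: algHom_eq. Qed.

Definition fun_modHom X Y (h : X -> Y) :
    twModHom (TwModule (fun_mod Y)) (TwModule (fun_mod X)) :=
  @TwModHom _ _ _ (TwModule (fun_mod Y)) (TwModule (fun_mod X)) (setHom_pre R h)
    (fun_modHom_proof h).

End FunctionAlgebra.

Theorem theorem6p2 (R : finComPzRingType) :
  (forall n : nat, bijective (tensor_can R n)) /\
  exists S : coAlgStr (setHom R R),
    (forall (w : alg_op R) (f : setHom R R),
       tensor_can R (arity w) (coop S w f) = f \o @op_eval R R^o w) /\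
    let RR : coAlg R := CoAlg S in
    exists M : twMonoidStr RR,
    [/\ forall f g : RR, tw_mul M (odot_elt f g) = g \o f,
        tw_one M (@polyalgX R) = id
      & exists F : forall X : Type, twModStr M (setHom R X),
        (forall (X : Type) (phi : setHom R X) (f : RR),
           (tw_act (F X) phi : algHom RR (setHom R X)) f = f \o phi) /\
        exists Fmap : forall (X Y : Type) (h : X -> Y),
            twModHom (TwModule (F Y)) (TwModule (F X)),
          [/\ forall (X Y : Type) (h : X -> Y) (phi : setHom R Y),
                Fmap X Y h phi = phi \o h,
              forall X : Type, Fmap X X id = idMod (TwModule (F X))
            & forall (X Y Z : Type) (h : X -> Y) (k : Y -> Z),
                Fmap X Z (k \o h) = compMod (Fmap X Y h) (Fmap Y Z k)]].
Proof.
split=> [n|]; first exact: tensor_can_bij.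
exists (funStr R); split=> [w f|]; first exact: tensor_uncanK.
exists (fun_monoid R); split; [exact: fun_mulE | exact: fun_oneE |].
exists (@fun_mod R); split=> //; exists (@fun_modHom R).
(* In both functor laws the underlying maps agree by computation. *)
by split=> // *; apply: twModHom_eq.
Qed.
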